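(* Let $m\ge s\ge 1$ be integers and let $\Pi$ be a projective plane of order $q=2^m$. Let $S$ be a maximal arc of degree $2^s$ in $\Pi$ (so $|S|=n:=2^{m+s}-2^m+2^s$), and let $D$ be the associated Steiner $2$-$(n,2^s,1)$ design, whose points are the points of $S$ and whose blocks are the nonempty intersections of lines of $\Pi$ with $S$. Let $A$ be the incidence matrix of $D$, $C$ the binary linear code of length $n$ spanned by the rows of $A$, and let $d$ and $d^\perp$ denote the minimum distances of $C$ and $C^\perp$ respectively. (a) $d^\perp=2^m+2$ if the point set of $D$ contains a hyperoval of $\Pi$, and $d^\perp\ge 2^m+4$ otherwise. (b) $d$ is an even number with $d\le 2^s$. If $d=2^s$, then \[ 1+\left\lceil \log_2\Big(\sum_{i=0}^{t}\binom{n-1}{i}\Big)\right\rceil \le \mathrm{rank}_2 A \le n-1-\left\lfloor \log_2\Big(\sum_{i=0}^{2^{s-1}-1}\binom{n-1}{i}\Big)\right\rfloor, \] where $t=2^{m-1}$ if the point set of $D$ contains a hyperoval of $\Pi$, and $t=d^\perp/2-1\ge 2^{m-1}+1$ if it contains no hyperoval of $\Pi$.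
   Context: A projective plane of order $q$ is a Steiner $2$-$(q^2+q+1,q+1,1)$ design (points and lines, any two points on exactly one line). An $(m',k)$-arc in a projective plane of order $q$ is a set of $m'$ points such that every line contains at most $k$ of them; it is maximal if $m'=qk+k-q$, equivalently every line meets it in $0$ or $k$ points. A hyperoval of $\Pi$ is a maximal arc of degree $2$, i.e. a set of $q+2$ points meeting every line in $0$ or $2$ points. The incidence matrix of a design has rows indexed by blocks, columns by points, with entry $1$ iff the block contains the point; $\mathrm{rank}_2 A$ is its rank over $GF(2)$, which equals the dimension of $C$. $C^\perp$ is the dual code of $C$ with respect to the standard inner product over $GF(2)$. *)

(* Defs.v *)
From mathcomp Require Import all_boot all_algebra.

Set Implicit Arguments.
Unset Strict Implicit.
Unset Printing Implicit Defensive.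

(* Blocks form a set, so repeated blocks are excluded; in a Steiner design
   (lambda = 1) whose block size is at least t they cannot occur anyway. *)
Definition is_design (T : finType) (t v k lambda : nat)
    (X : {set T}) (B : {set {set T}}) : Prop :=
  [/\ #|X| = v,
      forall b : {set T}, b \in B -> b \subset X /\ #|b| = k
    & forall Y : {set T}, Y \subset X -> #|Y| = t ->
        #|[set b in B | Y \subset b]| = lambda].

Definition is_steiner_design (T : finType) (t v k : nat)
    (X : {set T}) (B : {set {set T}}) : Prop :=
  is_design t v k 1 X B.

Definition is_projective_plane (T : finType) (q : nat)
    (lines : {set {set T}}) : Prop :=
  is_steiner_design 2 (q ^ 2 + q + 1) (q + 1) [set: T] lines.

Section PlaneArcs.
Variables (T : finType) (lines : {set {set T}}).

Definition is_arc (m' k : nat) (S : {set T}) : bool :=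
  (#|S| == m') && [forall L in lines, #|L :&: S| <= k].

Definition is_maximal_arc (q k : nat) (S : {set T}) : bool :=
  is_arc (q * k + k - q) k S.

Definition is_hyperoval (q : nat) (H : {set T}) : bool :=
  is_maximal_arc q 2 H.

Definition contains_hyperoval (q : nat) (S : {set T}) : bool :=
  [exists H : {set T}, (H \subset S) && is_hyperoval q H].

Definition arc_blocks (S : {set T}) : {set {set T}} :=
  [set L :&: S | L in lines & L :&: S != set0].

End PlaneArcs.

(* Rows and columns follow the canonical enumerations of B and X. *)
Definition incidence_mx (T : finType) (X : {set T}) (B : {set {set T}}) :
    'M['F_2]_(#|B|, #|X|) :=
  (\matrix_(i < #|B|, j < #|X|) (enum_val j \in enum_val i)%:R)%R.

Definition row_code (b n : nat) (A : 'M['F_2]_(b, n)) : {set 'rV['F_2]_n} :=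
  [set c | (c <= A)%MS].

Definition dual_code (n : nat) (C : {set 'rV['F_2]_n}) : {set 'rV['F_2]_n} :=
  [set v : 'rV['F_2]_n | [forall c in C, (\sum_i v 0 i * c 0 i)%R == 0%R]].

Definition hamming_dist (n : nat) (x y : 'rV['F_2]_n) : nat :=
  #|[set i | x 0%R i != y 0%R i]|.

(* The default n bounds every Hamming distance, so this is the true minimum as
   soon as C has two words; it is only returned by convention otherwise. *)
Definition min_dist (n : nat) (C : {set 'rV['F_2]_n}) : nat :=
  \big[minn/n]_(p in setX C C | p.1 != p.2) hamming_dist p.1 p.2.

Definition binomial_sum (n t : nat) : nat := \sum_(0 <= i < t.+1) 'C(n, i).

(* Main.v *)
(* The words of the dual code are the subsets [W] of the arc that every line
   meets in an even number of points. Counting such a [W] along the [q + 1]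
   lines through one of its points shows that [#|W|] is even and, if [W] is
   nonempty, at least [q + 2], with equality exactly for hyperovals. As the arc
   itself is such a set, the words of the code have even weight. Both rank
   bounds are Hamming bounds, for the code and its dual punctured at one
   coordinate. *)

Require Import Defs.
From mathcomp Require Import all_boot all_order all_algebra.
From mathcomp Require Import zify.

Set Implicit Arguments.
Unset Strict Implicit.
Unset Printing Implicit Defensive.

Import Order.Theory GRing.Theory.

(** * Counting along the lines through a point of the plane *)

Section ProjectivePlane.
Variables (T : finType) (q : nat) (lines : {set {set T}}).
Hypotheses (q_gt0 : 0 < q) (plane : is_projective_plane q lines).

Definition pencil (p : T) : {set {set T}} := [set L in lines | p \in L].

Lemma card_pencil2 (p x : T) :
  p != x -> #|[set L in pencil p | x \in L]| = 1.
Proof.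
move=> px; have [_ _ /(_ [set p; x] (subsetT _))] := plane.
rewrite cards2 px => /(_ erefl) <-; apply: eq_card => L.
by rewrite !inE subUset !sub1set andbA.
Qed.

(** Every point other than [p] lies on exactly one line through [p], so exchanging the two sums
    counts each point of [W :\ p] once. *)
Lemma card_setD1_pencil (W : {set T}) (p : T) :
  \sum_(L in pencil p) #|(L :&: W) :\ p| = #|W :\ p|.
Proof.
under eq_bigr => L _ do rewrite -sum1_card big_mkcond.
rewrite exchange_big -sum1_card [RHS]big_mkcond /=; apply: eq_bigr => x _.
case: ifP => [|/negbT xW]; last first.
  rewrite big1 // => L _; move: xW.
  by rewrite !inE; case: (x != p) => //= /negbTE ->; rewrite andbF.
rewrite !inE => /andP[xp xW].
rewrite -[RHS](card_pencil2 (p := p) (x := x)) 1?eq_sym // -[RHS]sum1_card.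
rewrite -big_mkcondr; apply: eq_bigl => L.
by rewrite !inE xp xW andbT.
Qed.

(** Applied to the whole plane, the count above says that the lines through [p], with [q] further
    points each, cover the other [q ^ 2 + q] points. *)
Lemma card_pencil (p : T) : #|pencil p| = q.+1.
Proof.
have [cT cL _] := plane.
have := card_setD1_pencil setT p.
rewrite (eq_bigr (fun=> q)) => [|L]; last first.
  rewrite !inE setIT => /andP[/cL[_ cLq] pL].
  by have := cardsD1 p L; rewrite pL cLq; lia.
rewrite sum_nat_const; have := cardsD1 p setT; rewrite inE cT; nia.
Qed.

(** Each of the [q + 1] lines through [p] has at most [k - 1] further points of [S]. The size of a
    maximal arc makes the total exactly [(q + 1) * (k - 1)], so no line can fall short. *)
Lemma maximal_arc_line (k : nat) (S : {set T}) (p : T) (L : {set T}) :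
  0 < k -> is_maximal_arc lines q k S -> p \in S -> L \in pencil p ->
  #|L :&: S| = k.
Proof.
move=> k_gt0 /andP[/eqP cS /'forall_implyP arcS] pS pL.
have DS M : M \in pencil p -> #|M :&: S| = (#|(M :&: S) :\ p|).+1.
  by rewrite !inE => /andP[_ pM]; rewrite (cardsD1 p) !inE pM pS.
have le M : M \in pencil p ->
    #|(M :&: S) :\ p| <= k.-1 ?= iff (#|(M :&: S) :\ p| == k.-1).
  move=> pM; split=> //; have := arcS M; rewrite DS //.
  by move: pM; rewrite inE => /andP[-> _] /(_ isT); lia.
have [_] := leqif_sum le; rewrite card_setD1_pencil sum_nat_const card_pencil.
have -> : #|S :\ p| = q.+1 * k.-1 by have := cardsD1 p S; rewrite pS; nia.
rewrite eqxx => /esym/'forall_implyP/(_ L pL)/eqP.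
by have := DS L pL; lia.
Qed.

Definition even_set (W : {set T}) : bool :=
  [forall L in lines, ~~ odd #|L :&: W|].

Lemma maximal_arc_even_set (k : nat) (S : {set T}) :
  0 < k -> ~~ odd k -> is_maximal_arc lines q k S -> even_set S.
Proof.
move=> k_gt0 kE arcS; apply/'forall_implyP=> L lL.
have [->|[p]] := set_0Vmem (L :&: S); first by rewrite cards0.
rewrite inE => /andP[pL pS].
by rewrite (maximal_arc_line k_gt0 arcS pS) // inE lL.
Qed.

Lemma even_set_pencil (W : {set T}) (p : T) (L : {set T}) :
  even_set W -> p \in W -> L \in pencil p -> odd #|(L :&: W) :\ p|.
Proof.
move=> /'forall_implyP evW pW; rewrite inE => /andP[lL pL].
by have := evW L lL; rewrite (cardsD1 p) !inE pL pW /= negbK.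
Qed.

(* Each of the [q + 1] lines through a point of [W] carries an odd number of
   further points of [W], and these lines partition the rest of [W]. *)
Lemma odd_card_even_set (W : {set T}) :
  ~~ odd q -> even_set W -> ~~ odd #|W|.
Proof.
move=> qE evW; have [->|[p pW]] := set_0Vmem W; first by rewrite cards0.
rewrite (cardsD1 p) pW /= negbK -card_setD1_pencil.
suff -> : odd (\sum_(L in pencil p) #|(L :&: W) :\ p|) = odd #|pencil p|.
  by rewrite card_pencil.
rewrite -sum1_card; apply: (big_ind2 (fun a b => odd a = odd b)) => //.
  by move=> a b a' b'; rewrite !oddD => -> ->.
by move=> L /(even_set_pencil evW pW).
Qed.

(** An odd number is at least 1, so each of the [q + 1] lines through a point of [W] contributes a
    further point. *)
Lemma leq_card_even_set (W : {set T}) :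
  even_set W -> W != set0 -> q + 2 <= #|W|.
Proof.
move=> evW /set0Pn[p pW]; rewrite (cardsD1 p) pW -card_setD1_pencil.
suff: \sum_(L in pencil p) 1 <= \sum_(L in pencil p) #|(L :&: W) :\ p|.
  by rewrite sum_nat_const card_pencil; lia.
by apply: leq_sum => L /(even_set_pencil evW pW)/odd_gt0.
Qed.

(** This is the equality case of the previous bound: every line through a point of [W] then carries
    exactly one further point. *)
Lemma even_set_hyperoval (W : {set T}) :
  even_set W -> #|W| = q + 2 -> is_hyperoval lines q W.
Proof.
move=> evW cW; apply/andP; split; first by rewrite cW; lia.
apply/'forall_implyP=> L lL.
have [->|[p]] := set_0Vmem (L :&: W); first by rewrite cards0.
rewrite inE => /andP[pL pW]; have Lp : L \in pencil p by rewrite inE lL.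
have le M : M \in pencil p ->
    1 <= #|(M :&: W) :\ p| ?= iff (1 == #|(M :&: W) :\ p|).
  by move=> pM; split=> //; apply/odd_gt0/even_set_pencil.
have [_] := leqif_sum le.
rewrite card_setD1_pencil sum_nat_const card_pencil muln1.
have -> : #|W :\ p| = q.+1 by have := cardsD1 p W; rewrite pW; lia.
rewrite eqxx => /esym/'forall_implyP/(_ L Lp)/eqP cLW.
by rewrite (cardsD1 p) -cLW !inE pL pW.
Qed.

End ProjectivePlane.

(** * Binary linear codes: minimum distance, duality and the Hamming bound *)

Section BinaryCodes.

Definition supp (n : nat) (c : 'rV['F_2]_n) : {set 'I_n} :=
  [set i | c 0%R i != 0%R].

Lemma natr_F2_eq0 (n : nat) : (n%:R == 0 :> 'F_2)%R = ~~ odd n.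
Proof. by rewrite -(dvdn_pcharf (pchar_Fp (isT : prime 2))) dvdn2. Qed.

Lemma F2_natrE (x : 'F_2) : x = ((x != 0)%R : nat)%:R%R.
Proof. by case: x => -[|[|]] // ?; apply/val_inj. Qed.

Lemma hamming_distE (n : nat) (x y : 'rV['F_2]_n) :
  hamming_dist x y = #|supp (x - y)%R|.
Proof. by apply: eq_card => i; rewrite !inE !mxE subr_eq0. Qed.

Lemma supp_eq0 (n : nat) (c : 'rV['F_2]_n) : (supp c == set0) = (c == 0%R).
Proof.
apply/eqP/eqP => [c0|->]; last by apply/setP=> i; rewrite !inE mxE eqxx.
apply/rowP=> i; rewrite mxE; apply/eqP.
by have := in_set0 i; rewrite -c0 inE => /negbFE.
Qed.

Lemma min_dist_leq (n : nat) (C : {set 'rV['F_2]_n}) x y :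
  x \in C -> y \in C -> x != y -> min_dist C <= hamming_dist x y.
Proof.
move=> xC yC xy; rewrite /min_dist -minEnat.
pose P (p : _ * _) := (p \in setX C C) && (p.1 != p.2).
have Pxy : P (x, y) by rewrite /P inE xC yC.
exact: (bigmin_le_cond n (fun p => hamming_dist p.1 p.2) Pxy).
Qed.

Lemma min_dist_attained (n : nat) (C : {set 'rV['F_2]_n}) x y :
  x \in C -> y \in C -> x != y ->
  exists x' y', [/\ x' \in C, y' \in C, x' != y' &
                    min_dist C = hamming_dist x' y'].
Proof.
move=> xC yC xy.
pose P (p : _ * _) := (p \in setX C C) && (p.1 != p.2).
have Pxy : P (x, y) by rewrite /P inE xC yC.
have [[x' y'] /=] := arg_minnP (fun p => hamming_dist p.1 p.2) Pxy.
rewrite /P inE /= => /andP[/andP[x'C y'C] x'y'] minxy.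
exists x', y'; split=> //.
apply/eqP; rewrite eqn_leq min_dist_leq //=.
(* The default value [n] does not undercut the least distance, since a distance counts some of the
   [n] coordinates. *)
apply: (big_ind (leq (hamming_dist x' y'))) => [|a b|p /minxy //].
  by rewrite -[X in _ <= X]card_ord; apply: max_card.
by rewrite leq_min => -> ->.
Qed.

Lemma row_code_min_dist_leq (b n : nat) (A : 'M['F_2]_(b, n))
    (c : 'rV_n) :
  (c <= A)%MS -> c != 0%R -> min_dist (row_code A) <= #|supp c|.
Proof.
move=> cA c0; rewrite -[c in supp c]subr0 -hamming_distE.
by rewrite min_dist_leq ?inE ?sub0mx.
Qed.

(** By linearity, the difference of two closest words is a nonzero word whose weight is their
    distance. *)
Lemma row_code_min_dist_attained (b n : nat) (A : 'M['F_2]_(b, n))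
    (c : 'rV_n) :
  (c <= A)%MS -> c != 0%R ->
  exists c', [/\ (c' <= A)%MS, c' != 0%R & min_dist (row_code A) = #|supp c'|].
Proof.
move=> cA c0.
have cC : c \in row_code A by rewrite inE.
have zeroC : 0%R \in row_code A by rewrite inE sub0mx.
have [x [y [xA yA xy ->]]] := min_dist_attained cC zeroC c0.
exists (x - y)%R; rewrite hamming_distE subr_eq0; split=> //.
by move: xA yA; rewrite !inE => xA yA; rewrite addmx_sub ?eqmx_opp.
Qed.

Lemma dual_codeE (n : nat) (C : {set 'rV['F_2]_n}) (v : 'rV['F_2]_n) :
  (v \in dual_code C) = [forall c in C, (v *m c^T == 0)%R].
Proof.
rewrite inE; apply: eq_forallb => c; congr (_ ==> _).
rewrite [(v *m _)%R]mx11_scalar -(scalemx1) scaler_eq0 oner_eq0 orbF mxE.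
by under [in RHS]eq_bigr do rewrite mxE.
Qed.

(** Presenting the dual as a row space makes the results on row spaces available for it.
    Orthogonality to the rows of [A] extends to their combinations. *)
Lemma dual_row_code (b n : nat) (A : 'M['F_2]_(b, n)) :
  dual_code (row_code A) = row_code (kermx A^T).
Proof.
apply/setP=> v; rewrite dual_codeE inE sub_kermx.
apply/'forall_implyP/eqP => [vA|vA c].
  apply: trmx_inj; rewrite trmx_mul trmxK trmx0; apply/row_matrixP=> i.
  rewrite row_mul row0; apply: trmx_inj; rewrite trmx_mul trmxK trmx0.
  by apply/eqP/vA; rewrite inE row_sub.
by rewrite inE => /submxP[u ->]; rewrite trmx_mul mulmxA vA mul0mx.
Qed.

(** This is the size of a Hamming ball of radius [e], with error patterns represented by their
    supports. *)
Lemma card_small_subsets (I : finType) (D : {set I}) (e : nat) :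
  #|[set Y : {set I} | Y \subset D & #|Y| <= e]| = binomial_sum #|D| e.
Proof.
rewrite /binomial_sum; elim: e => [|e IHe].
  by rewrite big_nat1 -cards_draws; apply: eq_card => Y; rewrite !inE leqn0.
rewrite big_nat_recr //= -IHe -cards_draws -cardsUI [X in _ = _ + X]eq_card0.
  by rewrite addn0; apply: eq_card => Y; rewrite !inE leq_eqVlt orbC andb_orr.
by move=> Y; rewrite !inE; case: (Y \subset D) => //=; lia.
Qed.

(* The Hamming bound for the code punctured at the coordinate [i0]. *)
Lemma punctured_sphere_packing (b n e : nat) (A : 'M['F_2]_(b, n)) (i0 : 'I_n) :
  (forall c : 'rV_n, (c <= A)%MS -> c != 0%R -> e.*2 + 2 <= #|supp c|) ->
  2 ^ \rank A * binomial_sum (n - 1) e <= 2 ^ (n - 1).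
Proof.
move=> dA; set D := [set~ i0].
have cD : #|D| = n - 1 by rewrite cardsC1 card_ord subn1.
set balls := setX [set: 'rV['F_2]_(\rank A)]
                  [set Y : {set 'I_n} | Y \subset D & #|Y| <= e].
(* A pair consists of a message and an error pattern avoiding [i0]. Its image is the support of the
   received punctured word: the symmetric difference of codeword support and error set, restricted
   to [D]. *)
pose f (p : 'rV['F_2]_(\rank A) * {set 'I_n}) :=
  [set i in D | (i \in supp (p.1 *m row_base A)) != (i \in p.2)].
have finj : {in balls &, injective f}.
  move=> [u Y] [u' Y']; rewrite !inE /= => /andP[YD cY] /andP[Y'D cY'] eqf.
  have key i : i != i0 -> ((i \in supp (u *m row_base A)) != (i \in Y))
                       = ((i \in supp (u' *m row_base A)) != (i \in Y')).
    by move=> ii0; have /setP/(_ i) := eqf; rewrite !in_set /= in_set1 ii0 /=.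
  have eqY : u = u' -> Y = Y'.
    move=> uu'; apply/setP=> i; have [->|/key] := eqVneq i i0; last first.
      by rewrite uu'; do 3 case: (_ \in _).
    have nD (Z : {set 'I_n}) : Z \subset D -> (i0 \in Z) = false.
      by move=> /subsetP ZD; apply/negP => /ZD; rewrite !inE eqxx.
    by rewrite !nD.
  suff uu' : u = u' by rewrite uu' eqY.
  apply/eqP; rewrite -subr_eq0; apply: contraT => u0.
  have := dA ((u - u') *m row_base A)%R; rewrite -(eq_row_base A) submxMl.
  rewrite mulmx_free_eq0 ?row_base_free // => /(_ isT u0).
  (* If two pairs collide, their codewords agree outside [i0], [Y] and [Y']. The difference then has
     weight at most [2e + 1], too small for a nonzero codeword. *)
  suff /subset_leq_card : supp ((u - u') *m row_base A)%R
      \subset i0 |: (Y :|: Y').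
    rewrite cardsU1 => suppY dsupp; have [cYY' _] := leq_card_setU Y Y'.
    have {cYY'} := leq_trans cYY' (leq_add cY cY').
    have := leq_trans dsupp suppY; move: #|_ :|: _| => r.
    by case: (i0 \notin _); lia.
  apply/subsetP=> i; rewrite mulmxBl 2!in_setU in_set1.
  have [//|/key] := eqVneq i i0; rewrite /supp !in_set !mxE subr_eq0 /=.
  case: (i \in Y) (i \in Y') => [] [] //= eqi /eqP[].
  set a := (\sum_j _)%R in eqi *; set a' := (\sum_j _)%R in eqi *.
  rewrite [a]F2_natrE [a']F2_natrE.
  by move: eqi; rewrite !eqbF_neg !negbK => ->.
have /subset_leq_card : f @: balls \subset powerset D.
  apply/subsetP=> _ /imsetP[p _ ->]; rewrite inE.
  by apply/subsetP=> i /setIdP[].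
rewrite card_in_imset // card_powerset cardsX card_small_subsets cD.
by rewrite cardsT card_mx mul1n card_Fp.
Qed.

Lemma binomial_sum_gt0 (N e : nat) : 0 < binomial_sum N e.
Proof. by rewrite /binomial_sum big_nat_recl // bin0. Qed.

(** Solves for [r] the Hamming bound of a code of dimension [n - r]. The bound itself forces [r] to
    be positive, so [2 ^ (n - r)] can be cancelled to leave [V <= 2 ^ (r - 1)]. *)
Lemma up_log_packing (n r V : nat) : 0 < n -> r <= n -> 0 < V ->
  2 ^ (n - r) * V <= 2 ^ (n - 1) -> 1 + up_log 2 V <= r.
Proof.
move=> n_gt0 le_rn V_gt0 packing.
have : 2 ^ (n - r) <= 2 ^ (n - 1) by apply: leq_trans packing; apply: leq_pmulr.
rewrite leq_exp2l // => le_nr; have r_gt0 : 0 < r by lia.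
rewrite -(subnKC r_gt0) leq_add2l; apply: up_log_min => //.
rewrite -(leq_pmul2l (_ : 0 < 2 ^ (n - r))) ?expn_gt0 // -expnD.
by apply: leq_trans packing _; rewrite leq_exp2l //; lia.
Qed.

Lemma trunc_log_packing (n r V : nat) : 0 < V ->
  2 ^ r * V <= 2 ^ (n - 1) -> r <= n - 1 - trunc_log 2 V.
Proof.
move=> V_gt0 packing.
suff : 2 ^ (r + trunc_log 2 V) <= 2 ^ (n - 1) by rewrite leq_exp2l //; lia.
apply: leq_trans packing; rewrite expnD leq_pmul2l ?expn_gt0 //.
exact: trunc_logP.
Qed.

End BinaryCodes.

(** * Translation between words indexed by the arc and subsets of the arc *)

Section CharacteristicVectors.
Variables (T : finType) (S : {set T}).

Definition charv (W : {set T}) : 'rV['F_2]_#|S| :=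
  (\row_j (enum_val j \in W)%:R)%R.

Lemma charv_onto (v : 'rV['F_2]_#|S|) :
  exists2 W : {set T}, W \subset S & v = charv W.
Proof.
exists [set enum_val i | i in supp v].
  by apply/subsetP=> _ /imsetP[i _ ->]; apply: enum_valP.
apply/rowP=> j; rewrite mxE [LHS]F2_natrE mem_imset ?inE //.
exact: enum_val_inj.
Qed.

Lemma card_enum_val (W : {set T}) :
  #|[set j : 'I_#|S| | enum_val j \in W]| = #|S :&: W|.
Proof.
rewrite -(card_imset _ (@enum_val_inj _ (mem S))); apply: eq_card => x.
apply/imsetP/idP => [[j]|]; first by rewrite !inE => jW ->; rewrite enum_valP.
rewrite inE => /andP[xS xW]; exists (enum_rank_in xS x).
  by rewrite inE enum_rankK_in.
by rewrite enum_rankK_in.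
Qed.

Lemma card_supp_charv (W : {set T}) : W \subset S -> #|supp (charv W)| = #|W|.
Proof.
move=> /setIidPr WS; rewrite -{2}WS -card_enum_val; apply: eq_card => j.
by rewrite !inE mxE; case: (_ \in _); rewrite ?oner_eq0 ?eqxx.
Qed.

(** Each common point contributes a 1 to the inner product, which is then read modulo 2. *)
Lemma charv_dot (W V : {set T}) : W \subset S ->
  ((charv W *m (charv V)^T) == 0)%R = ~~ odd #|W :&: V|.
Proof.
move=> WS.
rewrite [(_ *m _)%R]mx11_scalar -scalemx1 scaler_eq0 oner_eq0 orbF mxE.
have -> : W :&: V = S :&: (W :&: V) by rewrite setIA (setIidPr WS).
rewrite -natr_F2_eq0 -card_enum_val -sum1dep_card natr_sum.
rewrite [in RHS]big_mkcond /=; congr (_ == _)%R; apply: eq_bigr => j _.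
by rewrite !mxE !inE -natrM mulnb; case: (_ && _).
Qed.

Lemma row_incidence (B : {set {set T}}) (i : 'I_#|B|) :
  row i (incidence_mx S B) = charv (enum_val i).
Proof. by apply/rowP=> j; rewrite !mxE. Qed.

Lemma charv_incidence (B : {set {set T}}) (b : {set T}) :
  b \in B -> (charv b <= incidence_mx S B)%MS.
Proof.
by move=> bB; rewrite -(enum_rankK_in bB bB) -row_incidence row_sub.
Qed.

Lemma dual_incidence (lines : {set {set T}}) (W : {set T}) : W \subset S ->
  (charv W <= kermx (incidence_mx S (arc_blocks lines S))^T)%MS
    = even_set lines W.
Proof.
set A := incidence_mx _ _ => WS.
have LW L : L :&: W = W :&: (L :&: S) by rewrite setICA (setIidPl WS).
apply/idP/'forall_implyP => [|evW].
  (* A line missing [S] gives no block, but it meets [W] in no point either, so its parity condition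
     is automatic. *)
  rewrite sub_kermx => /eqP WA L lL; have [L0|L0] := eqVneq (L :&: S) set0.
    by rewrite LW L0 setI0 cards0.
  rewrite LW -charv_dot //.
  have /charv_incidence/submxP[u ->] : L :&: S \in arc_blocks lines S.
    by apply/imsetP; exists L; rewrite ?inE ?lL.
  by rewrite trmx_mul mulmxA WA mul0mx.
rewrite sub_kermx; apply/eqP/trmx_inj; rewrite trmx_mul trmxK trmx0.
apply/row_matrixP=> i; rewrite row_mul row0; apply: trmx_inj.
rewrite trmx_mul trmxK trmx0 row_incidence; apply/eqP; rewrite charv_dot //.
have /imsetP[L /setIdP[lL _] ->] := enum_valP i.
by rewrite -LW evW.
Qed.

End CharacteristicVectors.

(** * The minimum distances of the two codes and the rank bounds *)

Theorem theorem2p3 (m s : nat) (T : finType) (lines : {set {set T}})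
    (S : {set T}) :
  1 <= s -> s <= m ->
  is_projective_plane (2 ^ m) lines ->
  is_maximal_arc lines (2 ^ m) (2 ^ s) S ->
  let n := 2 ^ (m + s) - 2 ^ m + 2 ^ s in
  let A := incidence_mx S (arc_blocks lines S) in
  let C := row_code A in
  let d := min_dist C in
  let dperp := min_dist (dual_code C) in
  let hyp := contains_hyperoval lines (2 ^ m) S in
  [/\ (hyp -> dperp = 2 ^ m + 2) /\ (~~ hyp -> 2 ^ m + 4 <= dperp),
      ~~ odd d /\ d <= 2 ^ s
    & d = 2 ^ s ->
      let t := if hyp then 2 ^ (m - 1) else dperp %/ 2 - 1 in
      [/\ ~~ hyp -> ~~ odd dperp /\ 2 ^ (m - 1) + 1 <= t,
          1 + up_log 2 (binomial_sum (n - 1) t) <= \rank A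
        & \rank A <=
            n - 1 - trunc_log 2 (binomial_sum (n - 1) (2 ^ (s - 1) - 1))]].
Proof.
move=> s_gt0 le_sm plane arcS n A C d dperp hyp.
have [E2m E2s] : 2 ^ m = (2 ^ (m - 1)).*2 /\ 2 ^ s = (2 ^ (s - 1)).*2.
  by rewrite -!muln2 -!expnSr; split; congr (2 ^ _); lia.
have q_gt0 : 0 < 2 ^ m by rewrite expn_gt0.
have k_gt0 : 0 < 2 ^ s by rewrite expn_gt0.
have half_gt0 j : 0 < 2 ^ (j - 1) by rewrite expn_gt0.
have qE : ~~ odd (2 ^ m) by rewrite E2m odd_double.
have kE : ~~ odd (2 ^ s) by rewrite E2s odd_double.
have cS : #|S| = n.
  have /andP[/eqP -> _] := arcS.
  by rewrite /n expnD addnBAC // leq_pmulr.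
have /set0Pn[p pS] : S != set0 by rewrite -card_gt0 cS /n; lia.
pose i0 : 'I_#|S| := enum_rank_in pS p.
have evS : even_set lines S by apply: maximal_arc_even_set arcS.
have charv_neq0 (W : {set T}) : W \subset S -> W != set0 -> charv S W != 0%R.
  by move=> WS; rewrite -supp_eq0 -!card_gt0 card_supp_charv.
have dualW (v : 'rV_#|S|) : (v <= kermx A^T)%MS -> v != 0%R ->
    exists W : {set T},
      [/\ W \subset S, even_set lines W, W != set0 & #|supp v| = #|W|].
  have [W WS ->] := charv_onto v; rewrite dual_incidence // => evW.
  rewrite -supp_eq0 -card_gt0 card_supp_charv // => W0.
  by exists W; rewrite -card_gt0.
(* The arc itself is a nonempty even set, so the dual code is nonzero and its minimum distance is
   the weight of a word. *)
have [v0 [v0K v0N dperpE]] : exists v : 'rV_#|S|,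
    [/\ (v <= kermx A^T)%MS, v != 0%R & dperp = #|supp v|].
  rewrite /dperp dual_row_code.
  apply: (@row_code_min_dist_attained _ _ _ (charv S S)).
    by rewrite dual_incidence.
  by apply: charv_neq0 => //; apply/set0Pn; exists p.
have dperpW (W : {set T}) : W \subset S -> even_set lines W ->
    W != set0 -> dperp <= #|W|.
  move=> WS evW W0; rewrite -(card_supp_charv WS) /dperp dual_row_code.
  by apply: row_code_min_dist_leq; rewrite ?dual_incidence ?charv_neq0.
have dperp_even : ~~ odd dperp.
  have [W [_ evW _ cW]] := dualW _ v0K v0N.
  by rewrite dperpE cW (odd_card_even_set q_gt0 plane).
have dperp_hyp : hyp -> dperp = 2 ^ m + 2.
  move=> /existsP[H /andP[HS hypH]]; apply/eqP; rewrite eqn_leq.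
  have cH : #|H| = 2 ^ m + 2 by have /andP[/eqP -> _] := hypH; clear; lia.
  rewrite -{1}cH dperpW //=; first last.
  - by rewrite -card_gt0 cH addn2.
  - exact: (maximal_arc_even_set q_gt0 plane _ _ hypH).
  have [W [_ evW W0 cW]] := dualW _ v0K v0N.
  by rewrite dperpE cW (leq_card_even_set q_gt0 plane).
have dperp_nhyp : ~~ hyp -> 2 ^ m + 4 <= dperp.
  move=> /existsPn nhyp; have [W [WS evW W0 cW]] := dualW _ v0K v0N.
  have := leq_card_even_set q_gt0 plane evW W0.
  have : #|W| != 2 ^ m + 2.
    apply: contra (nhyp W) => /eqP cW2; rewrite WS.
    exact: (even_set_hyperoval q_gt0 plane).
  (* The value [2 ^ m + 2] is excluded by the absence of hyperovals and [2 ^ m + 3] by parity. *)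
  rewrite -cW -dperpE; move: dperp_even; rewrite E2m.
  by move: (dperp) => D; clear; lia.
have C_even (c : 'rV_#|S|) : (c <= A)%MS -> ~~ odd #|supp c|.
  have [W WS ->] := charv_onto c; rewrite card_supp_charv // => WA.
  have: charv S S \in dual_code C by rewrite dual_row_code inE dual_incidence.
  rewrite dual_codeE => /'forall_implyP/(_ (charv S W)).
  by rewrite inE WA charv_dot // (setIidPr WS); apply.
(* Any line through [p] cuts out a block of [2 ^ s] points, which bounds [d] from above. *)
have [b [bA b0 bk]] : exists b : 'rV_#|S|,
    [/\ (b <= A)%MS, b != 0%R & #|supp b| = 2 ^ s].
  have : 0 < #|pencil lines p| by rewrite (card_pencil q_gt0 plane).
  rewrite card_gt0 => /set0Pn[L Lp].
  have cLS := maximal_arc_line q_gt0 plane k_gt0 arcS pS Lp.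
  have LS0 : L :&: S != set0 by rewrite -card_gt0 cLS.
  exists (charv S (L :&: S)).
  rewrite card_supp_charv ?charv_neq0 ?subsetIr ?charv_incidence //.
  by apply/imsetP; exists L; rewrite // inE LS0 andbT; case/setIdP: Lp.
have [c [cA c0 dE]] := row_code_min_dist_attained bA b0.
split; first by [].
  by rewrite /d dE C_even // -dE -bk row_code_min_dist_leq.
move=> d2s t.
(* In both cases [t] is half of [dperp] minus 1, the error radius that the Hamming bound allows for
   the punctured dual code. *)
have tE : t.*2 + 2 = dperp.
  move: dperp_even dperp_hyp dperp_nhyp; rewrite /t E2m.
  move: (dperp) (hyp) (2 ^ (m - 1)) (half_gt0 m) => D [] N; clear.
    by move=> _ _ /(_ isT) -> _; lia.
  by move=> N_gt0 DE _ /(_ isT); lia.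
set r := \rank A; have rn : r <= n by rewrite -cS rank_leq_col.
have n_gt0 : 0 < n by rewrite -cS card_gt0; apply/set0Pn; exists p.
split.
- move=> nh; split=> //; move: (dperp_nhyp nh); rewrite -tE E2m.
  by move: (t) => u; clear; lia.
(* The lower bound on the rank comes from the dual code, of dimension [n - r]. *)
- have dK (v : 'rV_#|S|) : (v <= kermx A^T)%MS -> v != 0%R ->
      t.*2 + 2 <= #|supp v|.
    by rewrite tE /dperp dual_row_code; apply: row_code_min_dist_leq.
  have := punctured_sphere_packing i0 dK.
  rewrite mxrank_ker mxrank_tr -/r cS => sp.
  exact: up_log_packing n_gt0 rn (binomial_sum_gt0 _ _) sp.
(* The upper bound comes from the code itself, where [d = 2 ^ s] gives the radius
   [2 ^ (s - 1) - 1]. *)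
- have dA (v : 'rV_#|S|) : (v <= A)%MS -> v != 0%R ->
      (2 ^ (s - 1) - 1).*2 + 2 <= #|supp v|.
    have -> : (2 ^ (s - 1) - 1).*2 + 2 = d.
      by rewrite d2s E2s; move: (2 ^ (s - 1)) (half_gt0 s); clear; lia.
    exact: row_code_min_dist_leq.
  have := punctured_sphere_packing i0 dA; rewrite -/r cS => sp.
  exact: trunc_log_packing (binomial_sum_gt0 _ _) sp.
Qed.
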